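(* Let $(X,T)$ be a topological space and let $(\widehat X,\widehat T)$ be the nonstandard $\Phi$-hull of $(X,T)$ for $\Phi=C(X,\mathbb R)$, with quotient map $q:\widetilde X\to\widehat X$. Then $(\widehat X,\widehat T)$ (together with the map $q|_X:X\to\widehat X$) coincides with the Hewitt realcompactification $\nu X$ of $(X,T)$.
   Context: Nonstandard setting. Let $S\supseteq X\cup\mathbb R$ be a set of individuals, with superstructure $V(S)=\bigcup_{k\ge 0}V_k(S)$, $V_0(S)=S$, $V_{k+1}(S)=V_k(S)\cup\mathcal P(V_k(S))$. A $\kappa$-saturated nonstandard model of $S$ is a superstructure $V({}^*S)$ with a map $A\mapsto {}^*A$ from $V(S)$ into $V({}^*S)$ satisfying: (Extension) ${}^*s=s$ for all $s\in S$; (Transfer) a bounded quantifier formula $\Psi(A_1,\dots,A_n)$ with constants in $V(S)$ is true iff $\Psi({}^*A_1,\dots,{}^*A_n)$ is true in $V({}^*S)$; (Saturation) every family of at most $\kappa$ internal sets with the finite intersection property has nonempty intersection. An entity of $V({}^*S)$ is internal if it is an element of ${}^*A$ for some $A\in V(S)$. Throughout, a $\kappa$-saturated model with $\kappa$ infinite and $\kappa>\operatorname{card}T$ is fixed; $X\subseteq {}^*X$. The standard topology ${}^sT$ on ${}^*X$ has base $\{{}^*G:G\in T\}$. $C(X,\mathbb R)$ is the ring of continuous real-valued functions on $(X,T)$. In ${}^*\mathbb R$: $\xi$ is finite if $|\xi|<n$ for some $n\in\mathbb N$; $\xi\approx\eta$ if $|\xi-\eta|<1/n$ for all $n\in\mathbb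 N$. For $\Phi=C(X,\mathbb R)$: $\widetilde X=\{\alpha\in{}^*X:{}^*f(\alpha)\text{ is finite for all }f\in C(X,\mathbb R)\}$ with the subspace topology from $({}^*X,{}^sT)$; $\alpha\sim\beta$ in $\widetilde X$ iff ${}^*f(\alpha)\approx{}^*f(\beta)$ for all $f\in C(X,\mathbb R)$; the nonstandard $\Phi$-hull is $\widehat X=\widetilde X/\!\sim$ with the quotient topology $\widehat T$. A topological space $Y$ is realcompact if for every nontrivial ring homomorphism $\pi:C(Y,\mathbb R)\to\mathbb R$ there is $y\in Y$ such that, for all $f\in C(Y,\mathbb R)$, $\pi(f)=0$ iff $f(y)=0$. The Hewitt realcompactification of $(X,T)$ is characterized (up to homeomorphism compatible with the maps from $X$) as a realcompact, completely regular Hausdorff space $N$ with a continuous map $e:X\to N$ with dense image such that every $f\in C(X,\mathbb R)$ has a unique continuous extension $\widehat f:N\to\mathbb R$, i.e. $\widehat f\circ e=f$. *)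

(* Defs.v *)
From HB Require Import structures.
From mathcomp Require Import all_boot all_order all_algebra.
From mathcomp Require Import all_classical all_reals all_analysis.

Set Implicit Arguments.
Unset Strict Implicit.
Unset Printing Implicit Defensive.

Import Order.TTheory GRing.Theory Num.Theory.
Import numFieldNormedType.Exports.

Local Open Scope classical_set_scope.
Local Open Scope ring_scope.

(** The members of V_(k+1)(S) = V_k(S) u P(V_k(S)) are the individuals and the
    subsets of V_k(S).  A given entity has a code in [Vcode S k] for all large
    enough k. *)
Fixpoint Vcode (S : Type) (k : nat) : Type :=
  if k is k'.+1 then (S + set (Vcode S k'))%type else S.

(** Two codes denote the same entity: equal individuals, or sets with the same
    elements. *)
Fixpoint Veq (S : Type) (j k : nat) {struct j} : Vcode S j -> Vcode S k -> Prop :=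
  match j, k return Vcode S j -> Vcode S k -> Prop with
  | 0, 0 => fun s t => s = t
  | 0, _.+1 => fun s y => if y is inl t then s = t else False
  | _.+1, 0 => fun x t => if x is inl s then s = t else False
  | j'.+1, k'.+1 => fun x y =>
      match x, y with
      | inl s, inl t => s = t
      | inr A, inr B =>
          (forall a, A a -> exists2 b, B b & @Veq S j' k' a b) /\
          (forall b, B b -> exists2 a, A a & @Veq S j' k' a b)
      | _, _ => False
      end
  end.

Lemma Veq_refl (S : Type) k (x : Vcode S k) : Veq x x.
Proof.
elim: k x => [|k IH] //= [s|A] //=.
by split=> a Aa; exists a.
Qed.

Lemma Veq_sym (S : Type) j k (x : Vcode S j) (y : Vcode S k) :
  Veq x y -> Veq y x.
Proof.
elim: j k x y => [|j IH] [|k] //=.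
- by move=> s [t|B].
- by move=> [s|A] t.
- move=> [s|A] [t|B] //= [AB BA]; split.
  + by move=> b /BA[a Aa ab]; exists a => //; exact: IH.
  + by move=> a /AB[b Bb ab]; exists b => //; exact: IH.
Qed.

Lemma Veq_trans (S : Type) i j k (x : Vcode S i) (y : Vcode S j)
  (z : Vcode S k) : Veq x y -> Veq y z -> Veq x z.
Proof.
elim: i j k x y z => [|i IH] [|j] [|k] //=.
- by move=> s t u -> .
- by move=> s t [u|C] // -> .
- by move=> s [t|B] u // -> .
- by move=> s [t|B] [u|C] // -> .
- by move=> [s|A] t u // -> .
- by move=> [s|A] t [u|C] // -> .
- by move=> [s|A] [t|B] u // -> .
- move=> [s|A] [t|B] [u|C] //=; first by move=> -> .
  move=> [AB BA] [BC CB]; split.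
  + move=> a /AB[b /BC[c Cc bc] ab]; exists c => //; exact: IH ab bc.
  + move=> c /CB[b /BA[a Aa ab] bc]; exists a => //; exact: IH ab bc.
Qed.

Definition preentity (S : Type) : Type := {k : nat & Vcode S k}.

HB.instance Definition _ (S : Type) := gen_eqMixin (preentity S).
HB.instance Definition _ (S : Type) := gen_choiceMixin (preentity S).

Definition preentity_eq (S : Type) (x y : preentity S) : bool :=
  `[< Veq (projT2 x) (projT2 y) >].

Lemma preentity_eq_refl (S : Type) : reflexive (@preentity_eq S).
Proof. by move=> x; apply/asboolP/Veq_refl. Qed.

Lemma preentity_eq_sym (S : Type) : symmetric (@preentity_eq S).
Proof. by move=> x y; apply/idP/idP => /asboolP h; apply/asboolP/Veq_sym. Qed.

Lemma preentity_eq_trans (S : Type) : transitive (@preentity_eq S).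
Proof.
by move=> y x z /asboolP xy /asboolP yz; apply/asboolP; exact: Veq_trans yz.
Qed.

Canonical preentity_equiv (S : Type) :=
  EquivRel (@preentity_eq S) (@preentity_eq_refl S) (@preentity_eq_sym S)
    (@preentity_eq_trans S).

Definition superstructure (S : Type) : Type :=
  {eq_quot (@preentity_equiv S)}%qT.

HB.instance Definition _ (S : Type) := Choice.on (superstructure S).
HB.instance Definition _ (S : Type) :=
  EqQuotient.on (superstructure S).

Section Superstructure.
Variable S : Type.
Local Notation V := (superstructure S).

Definition entity (k : nat) (x : Vcode S k) : V :=
  (\pi_V (existT (Vcode S) k x))%qT.

Definition indiv (s : S) : V := @entity 0 s.

Definition elem (u v : V) : Prop :=
  exists k (A : set (Vcode S k)),
    v = @entity k.+1 (inr A) /\ exists2 a, A a & u = entity a.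

(** V_k(S) *)
Definition level (k : nat) : set V := range (@entity k).

(** {u in V_k(S) | P u} *)
Definition sep (k : nat) (P : set V) : V :=
  @entity k.+1 (inr [set a | P (entity a)]).

Lemma entityP j k (x : Vcode S j) (y : Vcode S k) :
  entity x = entity y <-> Veq x y.
Proof.
rewrite /entity; split=> [/eqquotP/asboolP //|h].
by apply/eqquotP/asboolP.
Qed.

Lemma indiv_inj : injective indiv.
Proof. by move=> s t /entityP. Qed.

Lemma elem_entity k (A : set (Vcode S k)) u :
  elem u (@entity k.+1 (inr A)) <-> exists2 a, A a & u = entity a.
Proof.
split=> [[j [B [/entityP/= [AB BA] [b Bb ->]]]]|h]; last by exists k, A.
by have [a Aa ab] := BA _ Bb; exists a => //; apply/entityP/Veq_sym.
Qed.

Lemma elem_indiv u s : ~ elem u (indiv s).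
Proof. by case=> k [A [/entityP]]. Qed.

Lemma elem_sep k P u : elem u (sep k P) <-> level k u /\ P u.
Proof.
rewrite elem_entity; split=> [[a /= Pa ->]|[[a _ <-] Pa]]; last by exists a.
by split=> //; exists a.
Qed.

Lemma entity_cases u : (exists s, u = indiv s) \/
  exists k (A : set (Vcode S k)), u = @entity k.+1 (inr A).
Proof.
elim/quotW: u => -[[|k] x]; first by left; exists x.
case: x => [s|A]; last by right; exists k, A.
by left; exists s; apply/entityP.
Qed.

Lemma elem_ext u v : (forall s, u <> indiv s) -> (forall s, v <> indiv s) ->
  (forall w, elem w u <-> elem w v) -> u = v.
Proof.
case: (entity_cases u) => [[s ->] /(_ s)//|[j [A ->]] _].
case: (entity_cases v) => [[s ->] /(_ s)//|[k [B ->]] _] AB.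
apply/entityP; split.
- move=> a Aa; have /elem_entity[b Bb /entityP ab] :
    elem (entity a) (@entity k.+1 (inr B)).
    by apply/AB/elem_entity; exists a.
  by exists b.
- move=> b Bb; have /elem_entity[a Aa /entityP ab] :
    elem (entity b) (@entity j.+1 (inr A)).
    by apply/AB/elem_entity; exists b.
  by exists a => //; exact: Veq_sym.
Qed.

Lemma elem_nindiv u v s : elem u v -> v <> indiv s.
Proof. by move=> uv vs; move: uv; rewrite vs => /elem_indiv. Qed.

Lemma sep_nindiv k P s : sep k P <> indiv s.
Proof. by move/entityP. Qed.

Lemma level_succ_aux k u : level k u -> level k.+1 u.
Proof.
elim: k u => [|k IH] u [x _ <-].
  by exists (inl x) => //; apply/entityP.
case: x => [s|A]; first by exists (inl s) => //; apply/entityP.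
pose P := [set u | elem u (@entity k.+1 (inr A))].
exists (inr [set a : Vcode S k.+1 | P (entity a)] : Vcode S k.+2) => //.
rewrite -/(sep k.+1 P).
apply: elem_ext => [s|s|w]; [exact: sep_nindiv|by move/entityP|].
rewrite elem_sep /P /=; split=> [[]//|wA]; split=> //.
by apply: IH; move/elem_entity: wA => [a _ ->]; exists a.
Qed.

Lemma level_le j k : (j <= k)%N -> level j `<=` level k.
Proof.
move=> /subnK <-; elim: (k - j)%N => [//|n IH] u /IH.
by rewrite addSn; exact: level_succ_aux.
Qed.

(** V_(k+1)(S) = V_k(S) u P(V_k(S)) *)
Lemma level_succ k :
  level k.+1 = level k `|` [set sep k P | P in [set P | P `<=` level k]].
Proof.
apply/seteqP; split=> u.
- case=> -[s|A] _ <-.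
    left; apply: (@level_le 0) => //; exists s => //.
    by apply/entityP.
  right; exists [set w | elem w (@entity k.+1 (inr A))] => /=.
    by move=> w /= /elem_entity[a _ ->]; exists a.
  apply: elem_ext => [s|s|w]; [exact: sep_nindiv|by move/entityP|].
  rewrite elem_sep /=; split=> [[]//|wA]; split=> //.
  by move/elem_entity: wA => [a _ ->]; exists a.
- case; first exact: level_succ_aux.
  by case=> P _ <-; exists (inr [set a | P (entity a)]).
Qed.

Lemma level_cover u : exists k, level k u.
Proof. by elim/quotW: u => -[k x]; exists k; exists x. Qed.

Definition rank (u : V) : nat := projT1 (cid (level_cover u)).

Lemma level_rank u : level (rank u) u.
Proof. exact: projT2 (cid (level_cover u)). Qed.

Definition upair (u v : V) : V := sep (maxn (rank u) (rank v)) [set u; v].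

(** The Kuratowski pair (u, v) = {{u}, {u, v}}. *)
Definition opair (u v : V) : V := upair (upair u u) (upair u v).

Lemma elem_upair u v w : elem w (upair u v) <-> w = u \/ w = v.
Proof.
rewrite elem_sep; split=> [[]//|wuv]; split=> //.
by case: wuv => ->; (apply: level_le; last exact: level_rank);
  rewrite leq_max leqnn ?orbT.
Qed.

Lemma upairP u v z : z = upair u v <->
  [/\ elem u z, elem v z & forall w, elem w z -> w = u \/ w = v].
Proof.
split=> [->|[uz vz zuv]].
  by split; [apply/elem_upair; left|apply/elem_upair; right|move=> w /elem_upair].
apply: elem_ext => [s|s|w]; [exact: elem_nindiv uz|exact: sep_nindiv|].
by split=> [/zuv/elem_upair//|/elem_upair[] ->].
Qed.

End Superstructure.

(** Variables are de Bruijn indices; every quantifier is of the form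
    (forall x in v_i) or (exists x in v_i), and the bound variable x is v_0 in
    its scope.  Constants are values given to the free variables. *)
Inductive bformula : Type :=
  | BEq (i j : nat)
  | BMem (i j : nat)
  | BNot (p : bformula)
  | BAnd (p q : bformula)
  | BOr (p q : bformula)
  | BImp (p q : bformula)
  | BAll (i : nat) (p : bformula)
  | BEx (i : nat) (p : bformula).

Definition push (T : Type) (x : T) (e : nat -> T) : nat -> T :=
  fun n => if n is m.+1 then e m else x.

Fixpoint holds (S : Type) (p : bformula) (e : nat -> superstructure S) : Prop :=
  match p with
  | BEq i j => e i = e j
  | BMem i j => elem (e i) (e j)
  | BNot p => ~ holds p e
  | BAnd p q => holds p e /\ holds q e
  | BOr p q => holds p e \/ holds q e
  | BImp p q => holds p e -> holds q e
  | BAll i p => forall x, elem x (e i) -> holds p (push x e)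
  | BEx i p => exists x, elem x (e i) /\ holds p (push x e)
  end.

Definition internal (S S' : Type)
    (star : superstructure S -> superstructure S') (u : superstructure S') :=
  exists A, elem u (star A).

(** A K-saturated nonstandard model of S, where the cardinal is that of the
    type K.  [nsindiv] is the set *S of individuals of the model and [nsemb] the
    inclusion of S into it; [star_indivs] says that the individuals of the model
    are the elements of the image of the entity S.  An internal individual has
    no elements, so the members of F in [saturation] are necessarily sets. *)
Record nonstandard_model (S K : Type) := NonstandardModel {
  nsindiv : Type;
  nsemb : S -> nsindiv;
  star : superstructure S -> superstructure nsindiv;
  star_indivs : star (sep 0 (range (@indiv S))) = sep 0 (range (@indiv nsindiv));
  extension : forall s : S, star (indiv s) = indiv (nsemb s);
  transfer : forall (p : bformula) (e : nat -> superstructure S),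
    holds p e <-> holds p (star \o e);
  saturation : forall F : set (superstructure nsindiv),
    (F #<= [set: K])%card ->
    F `<=` internal star ->
    (forall G : set (superstructure nsindiv), G `<=` F -> finite_set G ->
       exists u, forall A, G A -> elem u A) ->
    exists u, forall A, F A -> elem u A
}.

Section Transfer.
Variables (S K : Type) (M : nonstandard_model S K).
Local Notation V := (superstructure S).

Let env (s : seq V) : nat -> V := nth (sep 0 set0) s.

Lemma star_elem (u v : V) : elem u v <-> elem (star M u) (star M v).
Proof. exact: (transfer M (BMem 0 1) (env [:: u; v])). Qed.

Lemma star_upair (u v : V) : star M (upair u v) = upair (star M u) (star M v).
Proof.
apply/upairP.
have [+ _] := transfer M
  (BAnd (BMem 0 2) (BAnd (BMem 1 2) (BAll 2 (BOr (BEq 0 1) (BEq 0 2)))))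
  (env [:: u; v; upair u v]).
have /upairP[uz vz zuv] := erefl (upair u v).
by move=> /(_ (conj uz (conj vz zuv)))[uz' [vz' zuv']]; split.
Qed.

Lemma star_opair (u v : V) : star M (opair u v) = opair (star M u) (star M v).
Proof. by rewrite /opair !star_upair. Qed.

Lemma star_inter (a b c : V) :
  (forall x, elem x c <-> elem x a /\ elem x b) ->
  forall x, elem x (star M c) <-> elem x (star M a) /\ elem x (star M b).
Proof.
move=> abc x; split.
- have [+ _] := transfer M (BAll 2 (BAnd (BMem 0 1) (BMem 0 2)))
    (env [:: a; b; c]).
  by apply=> y /abc.
- move=> [xa xb].
  have [+ _] := transfer M (BAll 0 (BImp (BMem 0 2) (BMem 0 3)))
    (env [:: a; b; c]).
  by apply=> //= y ya yb; apply/abc.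
Qed.

End Transfer.

(** A set of individuals containing X and R, which may overlap. *)
Record individuals (X R : Type) := Individuals {
  indiv_sort :> Type;
  indX : X -> indiv_sort;
  indR : R -> indiv_sort;
  indX_inj : injective indX;
  indR_inj : injective indR
}.

Section Entities.
Variables (R : realType) (X : topologicalType) (S : individuals X R).
Local Notation V := (superstructure S).

Definition entX (x : X) : V := indiv (indX S x).
Definition entR (r : R) : V := indiv (indR S r).

(** The sets below lie in the levels over which the separation ranges: pairs
    of individuals are in V_2(S), triples ((x, y), z) in V_4(S). *)

Definition subset_ent (G : set X) : V := sep 0 [set entX x | x in G].

Definition fun_ent (f : X -> R) : V :=
  sep 2 [set opair (entX x) (entR (f x)) | x in [set: X]].

Definition abs_ent : V :=
  sep 2 [set opair (entR r) (entR `|r|) | r in [set: R]].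

Definition lt_ent : V :=
  sep 2 [set p | exists r s : R, r < s /\ p = opair (entR r) (entR s)].

Definition sub_ent : V :=
  sep 4 [set p | exists r s : R,
                   p = opair (opair (entR r) (entR s)) (entR (r - s))].

Lemma level_upair k (u v : V) : level k u -> level k v -> level k.+1 (upair u v).
Proof.
move=> ku kv; rewrite level_succ; right; exists [set u; v] => /=.
  by move=> w [] ->.
apply: elem_ext => [s|s|w]; [exact: sep_nindiv|exact: sep_nindiv|].
rewrite elem_upair elem_sep; split=> [[]//|wuv]; split=> //.
by case: wuv => ->.
Qed.

Lemma level_opair k (u v : V) : level k u -> level k v ->
  level k.+2 (opair u v).
Proof. by move=> ku kv; do !apply: level_upair. Qed.

Lemma level0X x : level 0 (entX x). Proof. by exists (indX S x). Qed.
Lemma level0R r : level 0 (entR r). Proof. by exists (indR S r). Qed.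

Lemma elem_subset_ent (G : set X) u :
  elem u (subset_ent G) <-> exists2 x, G x & u = entX x.
Proof.
rewrite elem_sep; split=> [[_ [x Gx <-]]|[x Gx ->]]; first by exists x.
by split; [exact: level0X|exists x].
Qed.

Lemma elem_fun_ent f u :
  elem u (fun_ent f) <-> exists x, u = opair (entX x) (entR (f x)).
Proof.
rewrite elem_sep; split=> [[_ [x _ <-]]|[x ->]]; first by exists x.
by split; [apply: level_opair; [exact: level0X|exact: level0R]|exists x].
Qed.

Lemma elem_abs_ent u :
  elem u abs_ent <-> exists r, u = opair (entR r) (entR `|r|).
Proof.
rewrite elem_sep; split=> [[_ [x _ <-]]|[x ->]]; first by exists x.
by split; [apply: level_opair; exact: level0R|exists x].
Qed.

Lemma elem_lt_ent u :
  elem u lt_ent <-> exists r s : R, r < s /\ u = opair (entR r) (entR s).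
Proof.
rewrite elem_sep; split=> [[]//|[r [s [rs ->]]]].
by split; [apply: level_opair; exact: level0R|exists r, s].
Qed.

Lemma elem_sub_ent u : elem u sub_ent <->
  exists r s : R, u = opair (opair (entR r) (entR s)) (entR (r - s)).
Proof.
rewrite elem_sep; split=> [[]//|[r [s ->]]]; split; last by exists r, s.
apply: level_opair; first by apply: level_opair; exact: level0R.
by apply: (@level_le _ 0) => //; exact: level0R.
Qed.

End Entities.

Section Hull.
Variables (R : realType) (X : topologicalType) (S : individuals X R).
Variables (K : Type) (M : nonstandard_model S K).
Local Notation V := (superstructure S).
Local Notation sV := (superstructure (nsindiv M)).

(** [star_val F u v]: *F(u) = v, for F the graph of a function. *)
Definition star_val (F : V) (u v : sV) : Prop := elem (opair u v) (star M F).

Definition star_lt (u v : sV) : Prop := elem (opair u v) (star M (lt_ent S)).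

Definition stdR (r : R) : sV := indiv (nsemb M (indR S r)).

(** |u| < r, the absolute value being the extended one. *)
Definition star_abs_lt (u : sV) (r : R) : Prop :=
  exists2 w, star_val (abs_ent S) u w & star_lt w (stdR r).

Definition ns_finite (u : sV) : Prop := exists n : nat, star_abs_lt u n%:R.

Definition ns_close (u v : sV) : Prop :=
  forall n : nat, (0 < n)%N ->
    exists2 d, star_val (sub_ent S) (opair u v) d & star_abs_lt d n%:R^-1.

Definition starX : Type :=
  set_type [set u : sV | elem u (star M (subset_ent S [set: X]))].

HB.instance Definition _ := Choice.on starX.

Definition star_subset (G : set X) : set starX :=
  [set a | elem (\val a) (star M (subset_ent S G))].

Lemma star_subset_cover : \bigcup_(G in @open X) star_subset G = setT.
Proof.
apply/seteqP; split=> // a _; exists setT; first exact: openT.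
exact: (set_mem (valP a)).
Qed.

Lemma star_subsetI (G H : set X) :
  star_subset (G `&` H) = star_subset G `&` star_subset H.
Proof.
apply/seteqP; suff GH a : star_subset (G `&` H) a <->
  (star_subset G `&` star_subset H) a by split=> a /GH.
apply: star_inter => u; rewrite !elem_subset_ent; split.
  by move=> [x [Gx Hx] ->]; split; exists x.
move=> [[x Gx ->] [y Hy xy]]; exists x => //; split=> //.
by rewrite (indX_inj (indiv_inj xy)).
Qed.

Lemma star_subset_join (G H : set X) (a : starX) : open G -> open H ->
  star_subset G a -> star_subset H a ->
  exists L, [/\ open L, star_subset L a
                & star_subset L `<=` star_subset G `&` star_subset H].
Proof.
move=> oG oH Ga Ha; exists (G `&` H); rewrite star_subsetI.
by split=> //; exact: openI.
Qed.

HB.instance Definition _ := @isBaseTopological.Build starX (set X) (@open X)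
  star_subset star_subset_cover star_subset_join.

Definition tilde_set : set starX :=
  [set a | forall f : X -> R, continuous f ->
     exists2 u, star_val (fun_ent S f) (\val a) u & ns_finite u].

(** As a subset coerced to a type, it carries the subspace topology. *)
Definition tilde : topologicalType := tilde_set.

Definition tilde_val (a : tilde) : sV := \val (\val a).

Definition tilde_equiv (a b : tilde) : Prop :=
  forall f : X -> R, continuous f ->
    exists u v, [/\ star_val (fun_ent S f) (tilde_val a) u,
                    star_val (fun_ent S f) (tilde_val b) v & ns_close u v].

(** The quotient is the type of classes, as sets; that [tilde_equiv] is an
    equivalence relation follows from transfer. *)
Definition tilde_class (a : tilde) : set tilde := [set b | tilde_equiv a b].

Definition tilde_classes : Type := {C : set tilde | exists a, C = tilde_class a}.

Definition class_of (a : tilde) : tilde_classes :=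
  exist _ (tilde_class a) (ex_intro _ a erefl).

Definition class_repr (C : tilde_classes) : tilde := projT1 (cid (proj2_sig C)).

Lemma class_reprK : cancel class_repr class_of.
Proof.
move=> C; rewrite /class_repr; case: cid => a /= Ca.
by case: C Ca => C CP /= Ca; exact: eq_exist.
Qed.

HB.instance Definition _ := isQuotient.Build tilde tilde_classes class_reprK.

Definition hull : topologicalType := quotient_topology tilde_classes.

Definition hull_proj (a : tilde) : hull :=
  (\pi_(quotient_topology tilde_classes) a)%qT.

Lemma hull_projE (a : tilde) : hull_proj a = class_of a.
Proof. by rewrite /hull_proj unlock. Qed.

Lemma stdX_star (x : X) :
  [set u : sV | elem u (star M (subset_ent S [set: X]))]
    (indiv (nsemb M (indX S x))).
Proof.
by rewrite /= -extension -star_elem elem_subset_ent; exists x.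
Qed.

Definition X_to_starX (x : X) : starX :=
  exist _ (indiv (nsemb M (indX S x))) (mem_set (stdX_star x)).

Lemma stdX_tilde (x : X) : tilde_set (X_to_starX x).
Proof.
move=> f _; exists (stdR (f x)).
  rewrite /star_val /stdR /= -!extension -star_opair -star_elem elem_fun_ent.
  by exists x.
have [n fn] : exists n : nat, `|f x| < n%:R.
  by exists (Num.bound `|f x|); exact: archi_boundP.
exists n; exists (stdR `|f x|).
  rewrite /star_val /stdR -!extension -star_opair -star_elem elem_abs_ent.
  by exists (f x).
rewrite /star_lt /stdR -!extension -star_opair -star_elem elem_lt_ent.
by exists `|f x|, n%:R.
Qed.

Definition X_to_tilde (x : X) : tilde :=
  exist _ (X_to_starX x) (mem_set (stdX_tilde x)).

Definition X_to_hull (x : X) : hull := hull_proj (X_to_tilde x).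

End Hull.

Definition contfun (R : realType) (Y : topologicalType) : Type :=
  {f : Y -> R | continuous f}.

Section RingHom.
Variables (R : realType) (Y : topologicalType).

(** Ring homomorphisms C(Y, R) -> R are not required to preserve 1, which
    follows from nontriviality. *)
Definition nontrivial_hom (p : contfun R Y -> R) : Prop :=
  [/\ (forall f g h : contfun R Y, sval h = sval f \+ sval g -> p h = p f + p g),
      (forall f g h : contfun R Y, sval h = sval f \* sval g -> p h = p f * p g)
    & exists f : contfun R Y, p f != 0].

Definition realcompact : Prop :=
  forall p : contfun R Y -> R, nontrivial_hom p ->
    exists y : Y, forall f : contfun R Y, p f = 0 <-> sval f y = 0.

End RingHom.

(** In [completely_regular_space], separation by a continuous real function is
    stated through uniformities; see [uniform_separatorP]. *)
Definition Hewitt_realcompactification (R : realType) (X N : topologicalType)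
    (e : X -> N) : Prop :=
  [/\ realcompact R N,
      completely_regular_space N /\ hausdorff_space N,
      continuous e,
      dense (range e)
    & forall f : X -> R, continuous f ->
        exists! g : N -> R, continuous g /\ g \o e = f].

(* Main.v *)
From HB Require Import structures.
Require Import Defs.
From mathcomp Require Import all_boot all_order all_algebra.
From mathcomp Require Import all_classical all_reals all_analysis.
From mathcomp Require Import finmap lra.

Set Implicit Arguments.
Unset Strict Implicit.
Unset Printing Implicit Defensive.

Local Open Scope classical_set_scope.

Import Order.TTheory GRing.Theory Num.Theory.
Import numFieldNormedType.Exports.
Local Open Scope ring_scope.

(** A point a of *X acts on subsets of X as the ultrafilter {A | a in *A}.  It
    lies in the tilde space exactly when every continuous f has a limit, the
    standard part of *f(a), along this ultrafilter, and two points are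
    identified in the hull exactly when they give the same limits.  A ring
    homomorphism phi on C(X, R) is the identity on constants and never kills a
    nowhere vanishing function, so the open sets {|g| < 1} with phi g = 0
    generate a proper filter; there are at most card T of them, so saturation
    puts a point in all their extensions, and its limits are the values of phi.
    Hence the hull is in bijection with the ring homomorphisms.  A second use of
    saturation shows that the quotient topology is the weak topology of the
    extended functions, which gives complete regularity.  Realcompactness
    follows because restriction along the dense image of X identifies C(hull, R)
    with C(X, R). *)

(** * Transfer of pairs and relations *)

Section PairFormulas.
Variable S : Type.
Local Notation V := (superstructure S).
Implicit Types (u v w : V) (e : nat -> V).

Lemma upair_inj u v u' v' :
  upair u v = upair u' v' -> u = u' /\ v = v' \/ u = v' /\ v = u'.
Proof.
move=> h.
have hw w : (w = u \/ w = v) <-> (w = u' \/ w = v').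
  by rewrite -!elem_upair h.
have [/(_ (or_introl erefl)) uu _] := hw u.
have [/(_ (or_intror erefl)) vv _] := hw v.
have [_ /(_ (or_introl erefl)) u'u] := hw u'.
have [_ /(_ (or_intror erefl)) v'v] := hw v'.
by case: uu => ?; case: vv => ?; case: u'u => ?; case: v'v => ?; subst; auto.
Qed.

Lemma opair_inj u v u' v' : opair u v = opair u' v' -> u = u' /\ v = v'.
Proof.
by move=> /upair_inj[][/upair_inj[][? ?] /upair_inj[][? ?]]; subst.
Qed.

Definition fupair (z i j : nat) : bformula :=
  BAnd (BMem i z) (BAnd (BMem j z) (BAll z (BOr (BEq 0 i.+1) (BEq 0 j.+1)))).

Arguments fupair : simpl never.

Lemma holds_fupair z i j e : holds (fupair z i j) e <-> e z = upair (e i) (e j).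
Proof.
rewrite upairP /fupair /=; split=> [[? [? h]]|[? ? h]]; split=> //; split=> //.
Qed.

(** Both quantifiers are bounded by the pair itself: the bound variables 1 and 0 are its Kuratowski
    members {v_i} and {v_i, v_j}. *)
Definition fopair (z i j : nat) : bformula :=
  BEx z (BEx z.+1 (BAnd (fupair 1 i.+2 i.+2)
    (BAnd (fupair 0 i.+2 j.+2) (fupair z.+2 1 0)))).

Arguments fopair : simpl never.

Lemma holds_fopair z i j e : holds (fopair z i j) e <-> e z = opair (e i) (e j).
Proof.
rewrite /fopair; split.
  move=> [a [_ [b [_ [ha [hb hz]]]]]].
  move/holds_fupair: hz; move/holds_fupair: hb; move/holds_fupair: ha.
  by move=> /= -> -> ->.
move=> ez; exists (upair (e i) (e i)); split.
  by rewrite ez; apply/elem_upair; left.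
exists (upair (e i) (e j)); split; first by rewrite /= ez;
  apply/elem_upair; right.
by split; [exact/holds_fupair|split; exact/holds_fupair].
Qed.

Definition fmem (F i j : nat) : bformula := BEx F (fopair 0 i.+1 j.+1).

Arguments fmem : simpl never.

Lemma holds_fmem F i j e :
  holds (fmem F i j) e <-> elem (opair (e i) (e j)) (e F).
Proof.
split=> [[p [pF hp]]|h].
  by move/holds_fopair: hp pF => /= ->.
by exists (opair (e i) (e j)); split=> //; exact/holds_fopair.
Qed.

(* The inner pair (u, v) of t = ((u, v), d) is reached through members of
   members of t, which keeps the quantifiers bounded. *)
Definition fmem3 (F i j k : nat) : bformula :=
  BEx F (BEx 0 (BEx 0 (BAnd (fopair 0 i.+3 j.+3) (fopair 2 0 k.+3)))).

Arguments fmem3 : simpl never.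

Lemma holds_fmem3 F i j k e : holds (fmem3 F i j k) e <->
  elem (opair (opair (e i) (e j)) (e k)) (e F).
Proof.
split.
  move=> [t [tF [s [_ [z [_ [hz ht]]]]]]].
  by move/holds_fopair: ht tF => /= ->; move/holds_fopair: hz => /= ->.
move=> h; exists (opair (opair (e i) (e j)) (e k)); split=> //.
exists (upair (opair (e i) (e j)) (opair (e i) (e j))); split.
  by apply/elem_upair; left.
exists (opair (e i) (e j)); split; first by apply/elem_upair; left.
by split; apply/holds_fopair.
Qed.

End PairFormulas.

Section StarRelations.
Variables (S K : Type) (M : nonstandard_model S K).
Local Notation V := (superstructure S).

Definition const_env (s : seq V) : nat -> V := nth (sep 0 set0) s.

(** Quantifiers in transferred formulas are bounded, so the entries of a pair in *F must be located
    in extensions of standard sets before such a formula can be applied to them. *)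
Lemma star_rel_typed (A B F : V) :
  (forall p, elem p F -> exists u v, [/\ elem u A, elem v B & p = opair u v]) ->
  forall u v, elem (opair u v) (star M F) ->
    elem u (star M A) /\ elem v (star M B).
Proof.
move=> FAB u v uvF.
pose fm := BAll 2 (BEx 1 (BEx 3 (fopair 2 1 0))).
have /(transfer M) : holds fm (const_env [:: A; B; F]).
  move=> p /FAB[u0 [v0 [u0A v0B ->]]]; exists u0; split=> //.
  by exists v0; split=> //; apply/holds_fopair.
move=> /(_ _ uvF)[u0 [u0A [v0 [v0B h]]]].
by move/holds_fopair: h => /opair_inj[-> ->].
Qed.

End StarRelations.

(** * Values of extended functions at points of *X *)

Section StarValues.
Variables (R : realType) (X : topologicalType) (S : individuals X R).
Variables (K : Type) (M : nonstandard_model S K).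
Local Notation V := (superstructure S).
Local Notation sV := (superstructure (nsindiv M)).
Local Notation starS := (@star_subset R X S K M).
Implicit Types (A B : set X) (f : X -> R) (a b : starX M).

Definition real_ent : V := sep 0 (range (@entR R X S)).

Lemma elem_real_ent u : elem u real_ent <-> exists r, u = entR S r.
Proof.
rewrite elem_sep; split=> [[_ [r _ <-]]|[r ->]]; first by exists r.
by split; [exact: level0R|exists r].
Qed.

Lemma entX_inj : injective (@entX R X S).
Proof. by move=> x y xy; exact: indX_inj (indiv_inj xy). Qed.

Lemma entR_inj : injective (@entR R X S).
Proof. by move=> r s rs; exact: indR_inj (indiv_inj rs). Qed.

Lemma opair_fun_ent f x r :
  elem (opair (entX S x) (entR S r)) (fun_ent S f) <-> r = f x.
Proof.
rewrite elem_fun_ent; split=> [[y /opair_inj[/entX_inj <- /entR_inj]]//|->].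
by exists x.
Qed.

Lemma opair_abs_ent r s :
  elem (opair (entR S r) (entR S s)) (abs_ent S) <-> s = `|r|.
Proof.
rewrite elem_abs_ent; split=> [[y /opair_inj[/entR_inj <- /entR_inj]]//|->].
by exists r.
Qed.

Lemma opair_lt_ent r s :
  elem (opair (entR S r) (entR S s)) (lt_ent S) <-> r < s.
Proof.
rewrite elem_lt_ent; split=> [[x [y [xy]]]|rs]; last by exists r, s.
by move=> /opair_inj[/entR_inj -> /entR_inj ->].
Qed.

Lemma opair_sub_ent r s t :
  elem (opair (opair (entR S r) (entR S s)) (entR S t)) (sub_ent S) <->
  t = r - s.
Proof.
rewrite elem_sub_ent; split=> [[x [y]]|->]; last by exists r, s.
by move=> /opair_inj[/opair_inj[/entR_inj -> /entR_inj ->] /entR_inj].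
Qed.

Lemma star_fun_typed f (u v : sV) : elem (opair u v) (star M (fun_ent S f)) ->
  elem u (star M (subset_ent S [set: X])) /\ elem v (star M real_ent).
Proof.
apply: star_rel_typed => p /elem_fun_ent[x ->].
exists (entX S x), (entR S (f x)); split=> //.
- by apply/elem_subset_ent; exists x.
- by apply/elem_real_ent; exists (f x).
Qed.

Lemma star_abs_typed (u v : sV) : elem (opair u v) (star M (abs_ent S)) ->
  elem u (star M real_ent) /\ elem v (star M real_ent).
Proof.
apply: star_rel_typed => p /elem_abs_ent[r ->].
by exists (entR S r), (entR S `|r|); split=> //; apply/elem_real_ent; eexists.
Qed.

Lemma stdR_star (r : R) : stdR M r = star M (entR S r).
Proof. by rewrite /stdR -extension. Qed.

Lemma star_fun_total f a :
  exists2 u, elem u (star M real_ent) & star_val (fun_ent S f) (\val a) u.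
Proof.
pose fm := BAll 0 (BEx 2 (fmem 4 1 0)).
have /(transfer M) : holds fm
    (const_env [:: subset_ent S [set: X]; real_ent; fun_ent S f]).
  move=> p /elem_subset_ent[x _ ->]; exists (entR S (f x)); split.
    by apply/elem_real_ent; exists (f x).
  by apply/holds_fmem/opair_fun_ent.
move=> /(_ _ (set_mem (valP a)))[u [uR /holds_fmem h]].
by exists u.
Qed.

(** Bridge from arithmetic in *R to the ultrafilter of [a]; each direction is the transfer of the
    corresponding implication for standard x. *)
Lemma star_abs_ltP f (r : R) a (u : sV) : star_val (fun_ent S f) (\val a) u ->
  star_abs_lt u r <-> starS [set x | `|f x| < r] a.
Proof.
move=> au; have [aX uR] := star_fun_typed au; split.
- case=> w uw wr; have [_ wR] := star_abs_typed uw.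
  (* Under the three quantifiers x, f x and |f x| are variables 2, 1, 0, and the constants are
     shifted by 3. *)
  pose fm := BAll 0 (BAll 2 (BAll 3 (BImp (fmem 5 2 1) (BImp (fmem 6 1 0)
    (BImp (fmem 7 0 8) (BMem 2 9)))))).
  have /(transfer M) : holds fm (const_env [:: subset_ent S [set: X]; real_ent;
      fun_ent S f; abs_ent S; lt_ent S; entR S r;
      subset_ent S [set x | `|f x| < r]]).
    move=> _ /elem_subset_ent[x _ ->] _ /elem_real_ent[y ->] _
      /elem_real_ent[z ->] /holds_fmem/opair_fun_ent yx
      /holds_fmem/opair_abs_ent zy /holds_fmem/opair_lt_ent zr.
    by apply/elem_subset_ent; exists x => //=; rewrite -yx -zy.
  move=> /(_ _ aX _ uR _ wR); apply; apply/holds_fmem => //.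
  by move: wr; rewrite /star_lt stdR_star.
- move=> ar.
  pose fm := BAll 6 (BAll 2 (BImp (fmem 4 1 0) (BEx 3 (BAnd (fmem 6 1 0)
    (fmem 7 0 8))))).
  have /(transfer M) : holds fm (const_env [:: subset_ent S [set: X]; real_ent;
      fun_ent S f; abs_ent S; lt_ent S; entR S r;
      subset_ent S [set x | `|f x| < r]]).
    move=> _ /elem_subset_ent[x xr ->] _ /elem_real_ent[y ->]
      /holds_fmem/opair_fun_ent yx; exists (entR S `|y|).
    split; first by apply/elem_real_ent; eexists.
    split; first by apply/holds_fmem/opair_abs_ent.
    by apply/holds_fmem/opair_lt_ent; rewrite yx.
  move=> /(_ _ ar _ uR)[|w [wR [/holds_fmem uw /holds_fmem wr]]].
    exact/holds_fmem.
  by exists w => //; rewrite /star_lt stdR_star.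
Qed.

(** [ns_close u v] unfolds to this relation at r = 1/n for every n > 0. *)
Definition star_dist_lt (u v : sV) (r : R) : Prop :=
  exists2 d, star_val (sub_ent S) (opair u v) d & star_abs_lt d r.

(** Two points are involved, hence one set from each of two ultrafilters. With [star_dist_lt_far]
    this reduces closeness in *R to estimates on X. *)
Lemma star_dist_lt_near f r A B a b (u v : sV) :
  (forall x y, A x -> B y -> `|f x - f y| < r) ->
  starS A a -> starS B b ->
  star_val (fun_ent S f) (\val a) u -> star_val (fun_ent S f) (\val b) v ->
  star_dist_lt u v r.
Proof.
move=> fAB aA bB au bv.
have [_ uR] := star_fun_typed au; have [_ vR] := star_fun_typed bv.
(* After the universal quantifiers x, y, f x, f y are variables 3, 2, 1, 0; the existential ones add
   the difference and its absolute value. *)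
pose fm := BAll 0 (BAll 2 (BAll 4 (BAll 5 (
   BImp (fmem 7 3 1) (BImp (fmem 7 2 0)
   (BEx 6 (BEx 7 (BAnd (fmem3 10 3 2 1) (BAnd (fmem 11 1 0)
   (fmem 12 0 13)))))))))).
have /(transfer M) : holds fm (const_env [:: subset_ent S A; subset_ent S B;
    real_ent; fun_ent S f; sub_ent S; abs_ent S; lt_ent S; entR S r]).
  move=> _ /elem_subset_ent[x Ax ->] _ /elem_subset_ent[y By ->]
    _ /elem_real_ent[z ->] _ /elem_real_ent[t ->]
    /holds_fmem/opair_fun_ent zx /holds_fmem/opair_fun_ent ty.
  exists (entR S (z - t)); split; first by apply/elem_real_ent; eexists.
  exists (entR S `|z - t|); split; first by apply/elem_real_ent; eexists.
  split; first by apply/holds_fmem3/opair_sub_ent.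
  split; first by apply/holds_fmem/opair_abs_ent.
  by apply/holds_fmem/opair_lt_ent; rewrite zx ty; exact: fAB.
move=> /(_ _ aA _ bB _ uR _ vR)[||d [dR [w [wR
  [/holds_fmem3 uvd [/holds_fmem dw /holds_fmem wr]]]]]].
- exact/holds_fmem.
- exact/holds_fmem.
- by exists d => //; exists w => //; rewrite /star_lt stdR_star.
Qed.

Lemma star_dist_lt_far f r A B a b (u v : sV) :
  (forall x y, A x -> B y -> ~ `|f x - f y| < r) ->
  starS A a -> starS B b ->
  star_val (fun_ent S f) (\val a) u -> star_val (fun_ent S f) (\val b) v ->
  ~ star_dist_lt u v r.
Proof.
move=> fAB aA bB au bv [d uvd [w dw wr]].
have [_ uR] := star_fun_typed au; have [_ vR] := star_fun_typed bv.
have [dR wR] := star_abs_typed dw.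
pose fm := BAll 0 (BAll 2 (BAll 4 (BAll 5 (BAll 6 (BAll 7 (
   BImp (fmem 9 5 3) (BImp (fmem 9 4 2) (BImp (fmem3 10 3 2 1)
     (BImp (fmem 11 1 0) (BNot (fmem 12 0 13))))))))))).
have /(transfer M) : holds fm (const_env [:: subset_ent S A; subset_ent S B;
    real_ent; fun_ent S f; sub_ent S; abs_ent S; lt_ent S; entR S r]).
  move=> _ /elem_subset_ent[x Ax ->] _ /elem_subset_ent[y By ->]
    _ /elem_real_ent[z ->] _ /elem_real_ent[t ->]
    _ /elem_real_ent[p ->] _ /elem_real_ent[q ->]
    /holds_fmem/opair_fun_ent zx /holds_fmem/opair_fun_ent ty
    /holds_fmem3/opair_sub_ent ps /holds_fmem/opair_abs_ent qp
    /holds_fmem/opair_lt_ent; rewrite qp ps zx ty; exact: fAB.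
move=> /(_ _ aA _ bB _ uR _ vR _ dR _ wR) h.
apply: h; try exact/holds_fmem; first exact/holds_fmem3.
by apply/holds_fmem; rewrite /= -stdR_star.
Qed.

(** * Points of *X as ultrafilters on X *)

Lemma star_subset0 : starS set0 = set0.
Proof.
apply/seteqP; split=> // a.
have /(transfer M) : holds (BAll 0 (BNot (BEq 0 0)))
    (const_env [:: subset_ent S (@set0 X)]).
  by move=> u /elem_subset_ent[].
by move=> /(_ _) h /h; exact.
Qed.

Lemma star_subsetS A B : A `<=` B -> starS A `<=` starS B.
Proof. by move=> /setIidl <-; rewrite star_subsetI => a []. Qed.

(** Maximality of the filter of [a]: the statement that A and its complement cover X is
    transferred. *)
Lemma star_subsetC A : starS (~` A) = ~` starS A.
Proof.
apply/seteqP; split=> a.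
  by move=> aC aA; have := star_subset0; rewrite -(setICr A) star_subsetI
    => /seteqP[/(_ a) + _]; apply.
move=> /= aA.
have /(transfer M) : holds (BAll 0 (BOr (BMem 0 2) (BMem 0 3)))
    (const_env [:: subset_ent S [set: X]; subset_ent S A; subset_ent S (~` A)]).
  move=> _ /elem_subset_ent[x _ ->] /=.
  by have [Ax|Ax] := pselect (A x); [left|right];
    apply/elem_subset_ent; exists x.
by move=> /(_ _ (set_mem (valP a)))[/aA|].
Qed.

Lemma star_subset_not A a : ~ starS A a -> starS (~` A) a.
Proof. by rewrite star_subsetC. Qed.

Lemma star_subset_and A B a : starS A a -> starS B a -> starS (A `&` B) a.
Proof. by rewrite star_subsetI. Qed.

Lemma star_subset_std A x : A x -> starS A (X_to_starX M x).
Proof.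
by move=> Ax; rewrite /star_subset/= -extension -star_elem elem_subset_ent;
  exists x.
Qed.

Lemma star_subset_nonempty A a : starS A a -> A !=set0.
Proof.
move=> Aa; apply/set0P/eqP => A0; move: Aa.
by rewrite A0 star_subset0.
Qed.

(** Finitely many members of [B] meet in a set of the proper filter [F], so a standard point
    witnesses the finite intersection property. *)
Lemma star_saturation (F : set_system X) (B : set_system X) : ProperFilter F ->
  B `<=` F -> (B #<= [set: K])%card ->
  exists a, forall A, B A -> starS A a.
Proof.
move=> PF BF BK.
(* For empty [B], saturation would return an entity not known to lie in *X; any standard point
   serves instead. *)
have [[A0 BA0]|B0] := pselect (exists A, B A); last first.
  have [x _] := filter_ex (@filterT _ F _); exists (X_to_starX M x) => A BA.
  by exfalso; apply: B0; exists A.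
pose g A := star M (subset_ent S A).
have [|_ [A BA <-]|G GB /finite_fsetP[D GD]|u hu] := @saturation _ _ M (g @` B).
- exact: card_le_trans (card_image_le _ _) BK.
(* Internality: each *A is an element of the extension of the power set of X. *)
- exists (sep 1 (range (@subset_ent R X S))).
  apply: (star_elem M _ _).1; apply/elem_sep; split; last by exists A.
  by exists (inr [set s | [set entX S x | x in A] (indiv s)]).
(* The finite subfamily consists of entities; [h] chooses a set in [B] behind each of them. *)
- pose h v := xget setT [set A | B A /\ g A = v].
  have hP v : G v -> B (h v) /\ g (h v) = v.
    by move=> /GB[A BA gA];
      apply: (@xgetPex _ _ [set A | B A /\ g A = v]); exists A.
  have /filter_ex[x hx] : F (\bigcap_(v in [set` D]) h v).
    apply: filter_bigI => v vD; have /hP[+ _] : G v by rewrite GD.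
    exact: BF.
  exists (\val (X_to_starX M x)) => v Gv; have [_ <-] := hP _ Gv.
  by apply: star_subset_std; apply: hx; rewrite -GD.
- have aX : elem u (star M (subset_ent S [set: X])).
    have /(transfer M) : holds (BAll 0 (BMem 0 2))
      (const_env [:: subset_ent S A0; subset_ent S [set: X]]).
      by move=> _ /elem_subset_ent[x _ ->]; apply/elem_subset_ent; exists x.
    by apply; apply: hu; exists A0.
  by exists (exist _ u (mem_set aX)) => A BA; exact: (hu _ (imageP g BA)).
Qed.

(* *f(a) is infinitely close to r, stated with extensions of subsets of X. *)
Definition near_at f a (r : R) : Prop :=
  forall e : R, 0 < e -> starS [set x | `|f x - r| < e] a.

(** Otherwise some standard x would have f x within |r - s|/2 of both limits. *)
Lemma near_at_unique f a r s : near_at f a r -> near_at f a s -> r = s.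
Proof.
move=> fr fs; apply/eqP/negP => /negP rs.
have e0 : 0 < `|r - s| / 2 by rewrite divr_gt0// normr_gt0 subr_eq0.
have := star_subset_and (fr _ e0) (fs _ e0).
move=> /star_subset_nonempty[x [/= xr xs]].
have := ler_distD (f x) r s; rewrite leNgt => /negP; apply.
by rewrite (distrC r (f x)); lra.
Qed.

Lemma near_at_std f x : near_at f (X_to_starX M x) (f x).
Proof. by move=> e e0; apply: star_subset_std; rewrite /= subrr normr0. Qed.

Lemma near_at_bounded f a r n : near_at f a r -> `|r| < n ->
  starS [set x | `|f x| < n] a.
Proof.
move=> fr rn; have e0 : 0 < n - `|r| by rewrite subr_gt0.
apply: star_subsetS (fr _ e0) => x /= h.
by have := ler_normB (f x) r; have := ler_normD (f x - r) r; rewrite subrK; lra.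
Qed.

(* The limit is the supremum of the r with *f(a) > r. *)
Lemma near_at_exists f a n : starS [set x | `|f x| < n] a ->
  exists r, near_at f a r.
Proof.
move=> an; pose E := [set r | starS [set x | r < f x] a].
have E0 : E (- n).
  by apply: star_subsetS an => x /=; rewrite ltr_norml => /andP[].
have En : ubound E n.
  move=> r rE; rewrite leNgt; apply/negP => nr.
  have := star_subset_and rE an; move=> /star_subset_nonempty[x [/= rx]].
  rewrite ltr_norml => /andP[_ xn].
  by have := lt_trans nr (lt_trans rx xn); rewrite ltxx.
have Esup : has_sup E by split; [exists (- n)|exists n].
exists (sup E) => e e0.
have [r rE re] := sup_adherent e0 Esup.
have : ~ E (sup E + e / 2).
  by move=> /(ub_le_sup (ex_intro _ n En)); lra.
move=> /star_subset_not ae; have := star_subset_and rE ae.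
by apply: star_subsetS => x [/= rx /negP]; rewrite -leNgt ltr_norml => xe; lra.
Qed.

Lemma tilde_setP a : tilde_set a <->
  forall f, continuous f -> exists r, near_at f a r.
Proof.
split=> [ta f cf|ta f cf].
  have [u au [n un]] := ta f cf.
  by apply: (@near_at_exists _ _ n%:R); apply/star_abs_ltP; eassumption.
have [u _ au] := star_fun_total f a; exists u => //.
have [r fr] := ta f cf.
exists (Num.bound `|r|); apply/(star_abs_ltP _ au).
by apply: near_at_bounded fr _; exact: archi_boundP.
Qed.

Lemma near_at_tilde f (a : tilde M) : continuous f ->
  exists r, near_at f (\val a) r.
Proof. by move=> cf; apply: (tilde_setP _).1 cf; exact: (set_mem (valP a)). Qed.

Lemma inv_nat_lt (e : R) : 0 < e -> exists2 n, (0 < n)%N & n%:R^-1 < e.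
Proof.
by move=> /ltr_add_invr[k]; rewrite add0r => ke; exists k.+1.
Qed.

(** A one-way implication suffices, since limits exist at [a] and are unique at [b]. *)
Lemma tilde_equivP (a b : tilde M) : tilde_equiv a b <->
  forall f, continuous f -> forall r, near_at f (\val a) r ->
    near_at f (\val b) r.
Proof.
split=> [ab f cf r fr|ab f cf].
- have [s fs] := near_at_tilde b cf.
  have [<-//|/eqP rs] := eqVneq s r; exfalso.
  (* Values within a third of |r - s| of r and of s are more than a third apart, hence more than
     1/n. *)
  have d0 : 0 < `|r - s| / 3.
    by rewrite divr_gt0// normr_gt0 subr_eq0; apply/eqP => /esym.
  have [n n0 nd] := inv_nat_lt d0.
  have [u [v [au bv uv]]] := ab f cf.
  apply: (star_dist_lt_far _ (fr _ d0) (fs _ d0) au bv (uv n n0)).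
  move=> x y /= xr ys; apply/negP; rewrite -leNgt.
  have := ler_distD (f x) r s; have := ler_distD (f y) (f x) s.
  by rewrite (distrC r (f x)); lra.
- have [r fr] := near_at_tilde a cf; have fr' := ab f cf r fr.
  have [u _ au] := star_fun_total f (\val a).
  have [v _ bv] := star_fun_total f (\val b).
  exists u, v; split=> // n n0.
  have e0 : 0 < n%:R^-1 / 2 :> R by rewrite divr_gt0// invr_gt0 ltr0n.
  apply: (star_dist_lt_near _ (fr _ e0) (fr' _ e0) au bv) => x y /= xr yr.
  by have := ler_distD r (f x) (f y); rewrite (distrC r (f y)); lra.
Qed.

(** The default 0 is taken only where f has no limit, which cannot happen for continuous f on the
    tilde space. *)
Definition std_part f a : R := xget 0 [set r | near_at f a r].

Lemma std_partE f a r : near_at f a r -> std_part f a = r.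
Proof.
move=> fr; apply: (@near_at_unique f a) => //.
by apply: (@xgetPex _ _ [set r | near_at f a r]); exists r.
Qed.

Lemma std_partP f (a : tilde M) : continuous f ->
  near_at f (\val a) (std_part f (\val a)).
Proof. by move=> /(near_at_tilde a)[r fr]; rewrite (std_partE fr). Qed.

Lemma std_part_dist f (a : tilde M) r e : continuous f ->
  starS [set x | `|f x - r| < e] (\val a) -> `|std_part f (\val a) - r| <= e.
Proof.
move=> cf ae; rewrite leNgt; apply/negP; rewrite -subr_gt0 => e0.
have := star_subset_and ae (std_partP a cf e0).
move=> /star_subset_nonempty[x [/= xr xs]].
by have := ler_distD (f x) (std_part f (\val a)) r;
  rewrite (distrC _ (f x)); lra.
Qed.

(** As an equality of values the relation is visibly an equivalence, which makes equal classes the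
    same as equivalent points. *)
Lemma tilde_equiv_std_part (a b : tilde M) : tilde_equiv a b <->
  forall f, continuous f -> std_part f (\val a) = std_part f (\val b).
Proof.
rewrite tilde_equivP; split=> ab f cf.
  by apply/esym/std_partE/(ab f cf)/std_partP.
by move=> r /std_partE <-; rewrite ab//; exact: std_partP.
Qed.

Lemma hull_proj_eq (a b : tilde M) :
  hull_proj a = hull_proj b <-> tilde_equiv a b.
Proof.
rewrite !hull_projE; split.
  move=> /(congr1 (@sval _ _))/= /seteqP[_ /(_ b)].
  by apply; apply/tilde_equiv_std_part.
move=> /tilde_equiv_std_part ab; apply: eq_exist.
apply/seteqP; split=> c /= /tilde_equiv_std_part h;
  apply/tilde_equiv_std_part => f cf.
  by rewrite -ab// h.
by rewrite ab// h.
Qed.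

(** * Extension of continuous functions to the hull *)

Definition hull_ext f (p : hull M) : R := std_part f (\val (class_repr p)).

Lemma hull_repr (p : hull M) : hull_proj (class_repr p) = p.
Proof. by rewrite hull_projE class_reprK. Qed.

Lemma hull_ext_proj f (a : tilde M) : continuous f ->
  hull_ext f (hull_proj a) = std_part f (\val a).
Proof.
by move=> cf; apply: (tilde_equiv_std_part _ _).1 cf;
  apply/hull_proj_eq/hull_repr.
Qed.

Lemma hull_ext_std f x : continuous f -> hull_ext f (X_to_hull M x) = f x.
Proof.
by move=> cf; rewrite /X_to_hull hull_ext_proj//;
  apply: std_partE; exact: near_at_std.
Qed.

Lemma open_star_subset A : open A -> open (starS A).
Proof.
by move=> oA; exists [set A] => [_ -> //|]; rewrite bigcup_set1.
Qed.

Lemma open_tilde (O : set (tilde M)) (a : tilde M) : open O -> O a ->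
  exists G, [/\ open G, starS G (\val a) &
    forall b : tilde M, starS G (\val b) -> O b].
Proof.
move=> [_ [D sD <-] <-] [G DG Ga]; exists G; split=> //; first exact: sD.
by move=> b Gb; exists G.
Qed.

Lemma nbhs_tilde A (a : tilde M) : open A -> starS A (\val a) ->
  nbhs a [set b : tilde M | starS A (\val b)].
Proof.
move=> oA Aa; apply: open_nbhs_nbhs; split=> //.
by exists (starS A) => //; exact: open_star_subset.
Qed.

Lemma open_dist_lt f r e : continuous f -> open [set x | `|f x - r| < e].
Proof.
move=> cf; rewrite (_ : [set x | _] = f @^-1` ball r e); last first.
  by apply/seteqP; split=> x /=; rewrite -ball_normE /ball_/= distrC.
by apply: open_comp; [move=> x _; exact: cf|exact: ball_open].
Qed.

Lemma open_norm_lt1 f : continuous f -> open [set x | `|f x| < 1].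
Proof.
move=> cf; rewrite (_ : [set x | _] = [set x | `|f x - 0| < 1]).
  exact: open_dist_lt.
by apply/seteqP; split=> x /=; rewrite subr0.
Qed.

(** By the universal property of the quotient, continuity is checked on the tilde space, where *{|f
    - r| < e} is open and standard parts stay within e of r. *)
Lemma hull_ext_continuous f : continuous f -> continuous (hull_ext f).
Proof.
move=> cf; apply/quotient_continuous => a.
apply/(@cvgrPdist_le _ _ _ (nbhs a) (nbhs_filter a)) => e e0.
have := nbhs_tilde (open_dist_lt _ _ cf) (std_partP a cf e0).
apply: (@filterS _ (nbhs a) (nbhs_filter a)) => b /= be.
by rewrite !hull_ext_proj// distrC; exact: std_part_dist be.
Qed.

(** * The topology of the hull *)

Lemma X_to_tilde_continuous : continuous (X_to_tilde M : X -> tilde M).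
Proof.
apply/continuousP => O oO; rewrite openE => x Ox.
have [G [oG Gx GO]] := open_tilde oO Ox.
have Gx' : G x.
  apply: contrapT => nGx.
  have := star_subset_and Gx (@star_subset_std (~` G) x nGx).
  by rewrite setICr star_subset0.
apply: (@filterS _ (nbhs x) _ G); last exact: open_nbhs_nbhs.
by move=> y Gy; apply: GO; exact: star_subset_std.
Qed.

Lemma X_to_hull_continuous : continuous (X_to_hull M : X -> hull M).
Proof.
move=> x; apply: (@continuous_comp _ (tilde M) (hull M) (X_to_tilde M)).
  exact: X_to_tilde_continuous.
exact: pi_continuous.
Qed.

(** A point in *G forces G to be nonempty, and every x in G is a standard point of *G. *)
Lemma X_to_hull_dense : dense (range (X_to_hull M : X -> hull M)).
Proof.
move=> O [p Op] oO; rewrite -(hull_repr p) in Op.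
have [G [oG /star_subset_nonempty[x Gx] GO]] := open_tilde oO Op.
by exists (X_to_hull M x); split=> //; apply: GO; exact: star_subset_std.
Qed.

Lemma hull_continuous_eq (g h : hull M -> R) : continuous g -> continuous h ->
  g \o X_to_hull M = h \o X_to_hull M -> g = h.
Proof.
move=> cg ch gh; apply/funext => p; apply/eqP; rewrite -subr_eq0.
apply: contrapT => /negP np.
have cgh : continuous (fun q => g q - h q).
  by move=> q; apply: continuousB; [exact: cg|exact: ch].
have oD : open ((fun q => g q - h q) @^-1` ~` [set 0]).
  by apply: open_comp; [move=> q _; exact: cgh|rewrite openC; exact: closed_eq].
have [|z [zD [x _ xz]]] := X_to_hull_dense _ oD.
  by exists p; exact/eqP.
apply: zD; rewrite -xz; apply/eqP; rewrite subr_eq0; apply/eqP.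
exact: (congr1 (fun k => k x) gh).
Qed.

(** Distinct classes differ in some standard part, so continuous real functions separate points. *)
Lemma hull_hausdorff : hausdorff_space (hull M).
Proof.
move=> p q pq; rewrite -(hull_repr p) -(hull_repr q).
apply/hull_proj_eq/tilde_equiv_std_part => f cf.
apply: (@norm_hausdorff _ R) => A B Ap Bq.
have [z [Az Bz]] :=
  pq _ _ (hull_ext_continuous cf Ap) (hull_ext_continuous cf Bq).
by exists (hull_ext f z).
Qed.

(** Puts every neighbourhood condition into the form {|g| < 1} used in the saturation arguments. *)
Lemma scaled_lt1 f r e : 0 < e ->
  [set x | `|(f x - r) / e| < 1] = [set x | `|f x - r| < e].
Proof.
move=> e0; apply/seteqP; split=> x /=;
  by rewrite normrM normfV (gtr0_norm e0) ltr_pdivrMr// mul1r.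
Qed.

Lemma continuous_scaled f r e : continuous f ->
  continuous (fun x => (f x - r) / e).
Proof.
move=> cf x; apply: cvgM; last exact: cvg_cst.
by apply: cvgB; [exact: cf|exact: cvg_cst].
Qed.

Lemma near_at_scaled f a r e : 0 < e -> near_at f a r ->
  near_at (fun x => (f x - r) / e) a 0.
Proof.
move=> e0 fr d d0; apply: star_subsetS (fr _ (mulr_gt0 d0 e0)) => x /=.
by rewrite subr0 normrM normfV (gtr0_norm e0) ltr_pdivrMr.
Qed.

Hypothesis open_le_K : ([set G : set X | open G] #<= [set: K])%card.

(* If no such g existed, the sets U = {|g| < 1} with *g(a) infinitesimal and
   the complements of the open G with *G inside the preimage of O would lie in
   the proper filter [F], and a point in all their extensions would be
   equivalent to a but outside the preimage of O.  No U is a G, so [code]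
   exhibits these sets as an image of the set of open sets. *)
Lemma hull_nbhs_base (O : set (hull M)) (a : tilde M) : open O ->
  O (hull_proj a) -> exists g, [/\ continuous g, near_at g (\val a) 0 &
    forall b : tilde M, starS [set x | `|g x| < 1] (\val b) -> O (hull_proj b)].
Proof.
move=> oO Oa; apply: contrapT => noU.
pose U := [set [set x | `|g x| < 1] |
  g in [set g | continuous g /\ near_at g (\val a) 0]].
pose G := [set A : set X | open A /\
  forall b : tilde M, starS A (\val b) -> O (hull_proj b)].
have UG A : U A -> ~ G A.
  by move=> [g [cg ga] <-] [_ gO]; apply: noU; exists g.
(* [A] is in [F] when some *B with [B] in [U] lies inside *A away from the preimage of [O], among
   tilde points. *)
pose F : set_system X := [set A | exists2 B, U B & forall b : tilde M,
  starS B (\val b) -> ~ O (hull_proj b) -> starS A (\val b)].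
have UI A B : U A -> U B -> exists2 C, U C & C `<=` A `&` B.
  move=> [g [cg ga] <-] [h [ch ha] <-].
  (* The sum |g| + |h| dominates both functions and is still infinitesimal at [a]. *)
  exists [set x | `| (`|g x| + `|h x|) | < 1].
    exists (fun x => `|g x| + `|h x|) => //; split.
      by move=> x; apply: cvgD; apply: cvg_norm; [exact: cg|exact: ch].
    move=> e e0; have e2 : 0 < e / 2 by rewrite divr_gt0.
    apply: star_subsetS (star_subset_and (ga _ e2) (ha _ e2)) => x /=.
    by rewrite !subr0 => -[gx hx]; rewrite ger0_norm ?addr_ge0//; lra.
  move=> x /=; rewrite ger0_norm ?addr_ge0// => ghx.
  by have := normr_ge0 (g x); have := normr_ge0 (h x); split; lra.
have U1 : U setT.
  exists (cst 0); last by apply/seteqP; split=> x //= _; rewrite normr0.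
  split; first exact: cst_continuous.
  by move=> e e0; apply: star_subsetS (set_mem (valP (\val a))) => x _ /=;
    rewrite subrr normr0.
have PF : ProperFilter F.
  split.
    (* If the empty set were in [F], no tilde point of *B would lie outside the preimage of [O], and
       the open set [B] would belong to [G]. *)
    move=> [B UB hB]; apply: (UG _ UB).
    split.
      by case: UB => g [cg _] <-; exact: open_norm_lt1.
    move=> b Bb; apply: contrapT => nOb; have := hB b Bb nOb.
    by rewrite star_subset0.
  split.
  - by exists setT => // b Tb _.
  - move=> A B [A' UA hA] [B' UB hB]; have [C UC CAB] := UI _ _ UA UB.
    exists C => // b /(star_subsetS CAB); rewrite star_subsetI => -[bA bB] nO.
    by apply: star_subset_and; [exact: hA|exact: hB].
  - move=> A B AB [A' UA hA]; exists A' => // b bA' nO.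
    by apply: (star_subsetS AB); exact: hA.
pose code A : set X := if `[< U A >] then A else ~` A.
have [||c hc] := @star_saturation F (U `|` [set ~` A | A in G]) PF.
- move=> A' [UA|[A [oA GA] <-]]; first by exists A'.
  exists setT => // b _ nO; apply: star_subset_not => /GA; exact: nO.
- apply: card_le_trans open_le_K; apply: card_le_trans (card_image_le code _).
  apply: subset_card_le => A [UA|[B GB <-]]; last first.
    exists B; first exact: GB.1.
    by rewrite /code asboolF// => /UG.
  exists A; last by rewrite /code asboolT.
  by case: UA => g [cg _] <-; exact: open_norm_lt1.
(* The scaled function (f - r)/e is infinitesimal at [a], so its set is in [U]; thus [c] inherits
   all limits of [a]. *)
- have cr f r : continuous f -> near_at f (\val a) r -> near_at f c r.
    move=> cf fr e e0; rewrite -scaled_lt1//; apply: hc; left.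
    exists (fun x => (f x - r) / e) => //.
    by split; [exact: continuous_scaled|exact: near_at_scaled].
  have tc : tilde_set c.
    apply/tilde_setP => f cf; have [r fr] := near_at_tilde a cf.
    by exists r; exact: cr.
  pose c' : tilde M := exist _ c (mem_set tc).
  have Oc : O (hull_proj c').
    rewrite -(_ : hull_proj a = hull_proj c')//.
    apply/hull_proj_eq/tilde_equivP.
    by move=> f cf r; exact: cr.
  (* This [A] belongs to [G], yet [c] was placed in the extension of its complement. *)
  have [A [oA cA GA]] := open_tilde oO Oc.
  by have := hc (~` A) (or_intror (imageP _ (conj oA GA)));
    rewrite star_subsetC; apply.
Qed.

Lemma hull_completely_regular : completely_regular_space (hull M).
Proof.
move=> p B cB Bp; apply/(@uniform_separatorP _ R).
have [||g [cg ga gB]] := @hull_nbhs_base (~` B) (class_repr p).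
- by rewrite openC.
- by rewrite hull_repr.
have cn : continuous (fun q : hull M => `|hull_ext g q|).
  by move=> q; exact: cvg_norm (@hull_ext_continuous g cg q).
(* This function is 0 at [p]; it is 1 on [B], since a class where the extension of g is below 1 in
   absolute value has its representative in *{|g| < 1}. *)
exists (cst 1 \min (fun q => `|hull_ext g q|)); split.
- by apply: min_fun_continuous => //; exact: cst_continuous.
- move=> _ [q _ <-] /=; rewrite in_itv/= le_min ler01 normr_ge0/=.
  by rewrite ge_min lexx.
- by move=> _ [_ -> <-] /=; rewrite /hull_ext (std_partE ga) normr0 min_r.
- move=> _ [q Bq <-] /=; apply: min_l; rewrite leNgt; apply/negP => gq.
  have := gB (class_repr q); rewrite hull_repr; apply => //.
  exact: near_at_bounded (std_partP _ cg) gq.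
Qed.

End StarValues.

(** * Ring homomorphisms and realcompactness *)

(** Nonnegative reals are squares, so [h] is monotone; it fixes the rationals, which are dense. *)
Lemma real_endo_id (R : realType) (h : R -> R) : {morph h : x y / x + y} ->
  {morph h : x y / x * y} -> h 1 = 1 -> h =1 id.
Proof.
move=> hD hM h1.
have h0 : h 0 = 0 by apply: (addrI (h 0)); rewrite -hD !addr0.
have hB : {morph h : x y / x - y}.
  by move=> x y; apply: (addIr (h y)); rewrite -hD !subrK.
pose hm := GRing.isMonoidMorphism.Build R R h (h1, hM).
pose hz := GRing.isZmodMorphism.Build R R h hB.
pose H : {rmorphism R -> R} := HB.pack h hz hm.
have hq q : h (ratr q) = ratr q by exact: (fmorph_rat H).
have h_ge0 x : 0 <= x -> 0 <= h x.
  by move=> /sqr_sqrtr <-; rewrite expr2 hM -expr2 sqr_ge0.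
have h_le x y : x <= y -> h x <= h y.
  by rewrite -subr_ge0 => /h_ge0; rewrite hB subr_ge0.
move=> x /=; apply/eqP; rewrite eq_le; apply/andP; split; rewrite leNgt;
  apply/negP => /rat_in_itvoo[q]; rewrite in_itv/= => /andP[lo hi].
- by have := h_le _ _ (ltW lo); rewrite hq leNgt hi.
- by have := h_le _ _ (ltW hi); rewrite hq leNgt lo.
Qed.

Section RingHoms.
Variables (R : realType) (Y : topologicalType).

Lemma contfunP (f : contfun R Y) : continuous (sval f).
Proof. exact: (proj2_sig f). Qed.

Definition cont_cst (c : R) : contfun R Y := exist _ _ (@cst_continuous Y R c).

Lemma cont_add_subproof (f g : contfun R Y) : continuous (sval f \+ sval g).
Proof. by move=> y; apply: cvgD;
  [exact: (@contfunP f)|exact: (@contfunP g)]. Qed.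

Definition cont_add (f g : contfun R Y) : contfun R Y :=
  exist _ _ (@cont_add_subproof f g).

Lemma cont_mul_subproof (f g : contfun R Y) : continuous (sval f \* sval g).
Proof. by move=> y; apply: cvgM;
  [exact: (@contfunP f)|exact: (@contfunP g)]. Qed.

Definition cont_mul (f g : contfun R Y) : contfun R Y :=
  exist _ _ (@cont_mul_subproof f g).

Variable phi : contfun R Y -> R.
Hypothesis phi_hom : nontrivial_hom phi.

Lemma hom_add f g : phi (cont_add f g) = phi f + phi g.
Proof. by case: phi_hom => h _ _; exact: h. Qed.

Lemma hom_mul f g : phi (cont_mul f g) = phi f * phi g.
Proof. by case: phi_hom => _ h _; exact: h. Qed.

Lemma contfun_ext (f g : contfun R Y) : sval f =1 sval g -> f = g.
Proof. by move=> /funext fg; exact: eq_sig_hprop. Qed.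

(** Constants form a copy of R, so [real_endo_id] applies once phi 1 = 1, obtained by cancelling a
    nonzero value of [phi]. *)
Lemma hom_cst c : phi (cont_cst c) = c.
Proof.
apply: (@real_endo_id R (phi \o cont_cst)) => [x y|x y|] /=.
- by rewrite -hom_add; congr phi; exact: contfun_ext.
- by rewrite -hom_mul; congr phi; exact: contfun_ext.
- have [_ _ [f f0]] := phi_hom; apply: (mulIf f0); rewrite -hom_mul mul1r.
  by congr phi; apply: contfun_ext => y /=; rewrite mul1r.
Qed.

(** Otherwise 1/f is continuous and 1 = phi f * phi (1/f) = 0. *)
Lemma hom_zero f : phi f = 0 -> exists y, sval f y = 0.
Proof.
move=> phif; apply: contrapT => f0.
have cV : continuous (fun y => (sval f y)^-1).
  move=> y; apply: cvgV; last exact: (@contfunP f).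
  by apply/eqP => fy; apply: f0; exists y.
have := hom_mul f (exist _ _ cV); rewrite phif mul0r.
rewrite (_ : cont_mul _ _ = cont_cst 1); last first.
  apply: contfun_ext => y /=; rewrite divff//.
  by apply/eqP => fy; apply: f0; exists y.
by rewrite hom_cst => /eqP; rewrite oner_eq0.
Qed.

End RingHoms.

Section Realcompactness.
Variables (R : realType) (X : topologicalType) (S : individuals X R).
Variables (K : Type) (M : nonstandard_model S K).
Local Notation starS := (@star_subset R X S K M).
Hypothesis open_le_K : ([set G : set X | open G] #<= [set: K])%card.

Lemma hom_std_part (phi : contfun R X -> R) : nontrivial_hom phi ->
  exists a : tilde M, forall f, std_part (sval f) (\val a) = phi f.
Proof.
move=> hphi.
pose U (g : contfun R X) := [set x | `|sval g x| < 1].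
pose F := filter_from [set g | phi g = 0] U.
have PF : ProperFilter F.
  apply: filter_from_proper; last first.
    by move=> g /(hom_zero hphi)[x gx]; exists x; rewrite /U/= gx normr0.
  apply: filter_from_filter; first by exists (cont_cst X 0); exact: hom_cst.
  (* The sum of squares stays in the kernel, and where it is below 1 so are |f| and |g|. *)
  move=> f g /= f0 g0; exists (cont_add (cont_mul f f) (cont_mul g g)).
    by rewrite /= hom_add// !hom_mul// f0 g0 mulr0 addr0.
  move=> x; rewrite /U/= ger0_norm ?addr_ge0 -?expr2 ?sqr_ge0// => fg.
  have := sqr_ge0 (sval f x); have := sqr_ge0 (sval g x) => g2 f2.
  by split; rewrite -(@expr_lt1 _ 2)// real_normK ?num_real//; lra.
have [||c hc] := @star_saturation R X S K M F (U @` [set g | phi g = 0]) PF.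
- by move=> _ [g g0 <-]; exists g.
- apply: card_le_trans open_le_K; apply: subset_card_le => _ [g _ <-] /=.
  exact: open_norm_lt1 (@contfunP _ _ g).
have cphi (f : contfun R X) : near_at (sval f) c (phi f).
  move=> e e0; rewrite -scaled_lt1//.
  (* The function (f - phi f)/e lies in the kernel because [phi] fixes constants. *)
  pose g := cont_mul (cont_add f (cont_cst X (- phi f))) (cont_cst X e^-1).
  by apply: (hc (U g)); exists g => //=;
    rewrite hom_mul// hom_add// !hom_cst// subrr mul0r.
have tc : tilde_set c.
  by apply/tilde_setP => f cf; exists (phi (exist _ f cf));
    exact: (cphi (exist _ f cf)).
by exists (exist _ c (mem_set tc)) => f; apply: std_partE; exact: cphi.
Qed.

Lemma hull_realcompact : realcompact R (hull M).
Proof.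
move=> pi pi_hom.
pose ext (f : contfun R X) : contfun R (hull M) :=
  exist _ _ (hull_ext_continuous (M := M) (@contfunP _ _ f)).
(* Uniqueness of extensions identifies the two rings and shows below that [ext] respects sums and
   products. *)
have extP (f : contfun R X) (h : contfun R (hull M)) :
    sval h \o X_to_hull M = sval f -> h = ext f.
  move=> hf; apply: contfun_ext => p; apply: (congr1 (fun k => k p)).
  apply: hull_continuous_eq; first exact: contfunP.
    exact: (hull_ext_continuous (@contfunP _ _ f)).
  by rewrite hf; apply/funext => x /=; rewrite hull_ext_std//;
    exact: (@contfunP _ _ f).
have cres (h : contfun R (hull M)) : continuous (sval h \o X_to_hull M).
  move=> x; apply: continuous_comp; first exact: X_to_hull_continuous.
  exact: contfunP.
pose res (h : contfun R (hull M)) : contfun R X := exist _ _ (cres h).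
have resK h : h = ext (res h) by exact: extP.
have ext_hom : nontrivial_hom (pi \o ext).
  have [piD piM [h h0]] := pi_hom; split.
  - move=> f g k kfg /=; apply: piD.
    rewrite -(extP k (cont_add (ext f) (ext g)))//.
    by rewrite kfg; apply/funext => x /=; rewrite !hull_ext_std//;
      exact: contfunP.
  - move=> f g k kfg /=; apply: piM.
    rewrite -(extP k (cont_mul (ext f) (ext g)))//.
    by rewrite kfg; apply/funext => x /=; rewrite !hull_ext_std//;
      exact: contfunP.
  - by exists (res h); rewrite /= -resK.
have [a ha] := hom_std_part ext_hom.
exists (hull_proj a) => h.
(* More than equality of zero sets holds: [pi] is evaluation at this point. *)
suff -> : pi h = sval h (hull_proj a) by [].
transitivity (pi (ext (res h))); first by rewrite -resK.
by rewrite -[LHS](ha (res h)) [in RHS](resK h) /= hull_ext_proj//; exact: cres.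
Qed.

End Realcompactness.

Theorem mainTheorem7 (R : realType) (X : topologicalType)
    (S : individuals X R) (K : Type) (M : nonstandard_model S K)
    (K_infinite : infinite_set [set: K])
    (open_le_K : ([set G : set X | open G] #<= [set: K])%card)
    (K_not_le_open : ~ ([set: K] #<= [set G : set X | open G])%card) :
  Hewitt_realcompactification R (X_to_hull M : X -> hull M).
Proof.
split.
- exact: hull_realcompact.
- by split; [exact: hull_completely_regular|exact: hull_hausdorff].
- exact: X_to_hull_continuous.
- exact: X_to_hull_dense.
- move=> f cf; have cF := hull_ext_continuous (M := M) cf.
  have Fe : hull_ext f \o X_to_hull M = f.
    by apply/funext => x /=; exact: hull_ext_std.
  exists (hull_ext f); split=> // g [cg ge].
  by apply: hull_continuous_eq => //; rewrite ge Fe.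
Qed.
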